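(* Let $n\geq 2$ and let $\Diamond:\mathcal{K}^n\to\mathcal{K}^n$ be an operator. Then $\Diamond$ is continuous, $\mathrm{GL}(n)$-covariant and satisfies a Rogers-Shephard type inequality if and only if there are real numbers $a,b\geq 0$ such that $\Diamond K=aK+b(-K)$ for all $K\in\mathcal{K}^n$.
   Context: $\mathcal{K}^n$ denotes the set of convex bodies (nonempty compact convex sets, not necessarily with interior points) in $\mathbb{R}^n$, with the Hausdorff metric; continuity is with respect to this metric. Addition of sets is Minkowski addition, $\lambda K=\{\lambda x: x\in K\}$ and $-K=\{-x:x\in K\}$. $\mathrm{Vol}$ is $n$-dimensional Lebesgue measure. An operator $\Diamond:\mathcal{K}^n\to\mathcal{K}^n$ is $\mathrm{GL}(n)$-covariant if $\Diamond(gK)=g\,\Diamond K$ for all $K\in\mathcal{K}^n$ and all $g\in\mathrm{GL}(n)$ (the general linear group of $\mathbb{R}^n$). It satisfies a Rogers-Shephard type inequality if there is a constant $C>0$ such that $\mathrm{Vol}(\Diamond K)\leq C\,\mathrm{Vol}(K)$ for all $K\in\mathcal{K}^n$. *)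

(* Defs.v *)
From HB Require Import structures.
From mathcomp Require Import all_boot all_order all_algebra.
From mathcomp Require Import all_classical all_reals all_analysis.
From mathcomp Require Import ring.

Set Implicit Arguments.
Unset Strict Implicit.
Unset Printing Implicit Defensive.

Import Order.TTheory GRing.Theory Num.Theory.
Import numFieldNormedType.Exports.

Local Open Scope classical_set_scope.
Local Open Scope ring_scope.

Section LebesgueTuple.
Context {R : realType}.

Definition cons_pair n (p : R * n.-tuple R) : n.+1.-tuple R :=
  [tuple of p.1 :: p.2].

Lemma measurable_cons_pair n : measurable_fun setT (@cons_pair n).
Proof. by apply: measurable_cons. Qed.

Section step.
Variables (n : nat) (mu : {sigma_finite_measure set (n.-tuple R) -> \bar R}).

Definition cons_measure : set (n.+1.-tuple R) -> \bar R :=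
  pushforward (lebesgue_measure \x mu)%E (@cons_pair n).

Let cons_measure0 : cons_measure set0 = 0%E.
Proof. by rewrite /cons_measure /pushforward preimage_set0 measure0. Qed.

Let cons_measure_ge0 A : (0 <= cons_measure A)%E.
Proof. by rewrite /cons_measure /pushforward; apply: integral_ge0 => *. Qed.

Let cons_measure_sigma_additive : semi_sigma_additive cons_measure.
Proof.
move=> F mF tF mUF; rewrite /cons_measure /pushforward preimage_bigcup.
apply: measure_semi_sigma_additive.
- by move=> k; rewrite -[X in measurable X]setTI; exact: measurable_cons_pair.
- apply/trivIsetP => /= i j _ _ ij; rewrite -preimage_setI.
  by move/trivIsetP : tF => /(_ _ _ _ _ ij) ->//; rewrite preimage_set0.
- rewrite -preimage_bigcup -[X in measurable X]setTI.
  exact: measurable_cons_pair.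
Qed.

HB.instance Definition _ := isMeasure.Build _ _ _ cons_measure
  cons_measure0 cons_measure_ge0 cons_measure_sigma_additive.

Let cons_measure_sigma_finite : sigma_finite setT cons_measure.
Proof.
have /sigma_finiteP[F [TF ndF Foo]] := sigma_finiteT (@lebesgue_measure R).
have /sigma_finiteP[G [TG ndG Goo]] := sigma_finiteT mu.
pose split_tuple (t : n.+1.-tuple R) : R * n.-tuple R :=
  (thead t, [tuple of behead t]).
have mS : measurable_fun setT split_tuple.
  apply/measurable_fun_pairP; split; first exact: (measurable_tnth ord0).
  exact: measurable_behead.
have consK : cancel (@cons_pair n) split_tuple.
  by case=> x t; congr (_, _); exact/val_inj.
exists (fun k => split_tuple @^-1` (F k `*` G k)).
  apply/esym/seteqP; split => // t _.
  have [k _ Fk] : (\bigcup_i F i) (split_tuple t).1 by rewrite -TF.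
  have [l _ Gl] : (\bigcup_i G i) (split_tuple t).2 by rewrite -TG.
  exists (maxn k l) => //; split => /=.
    by apply: (subsetPset _ _ (ndF _ _ (leq_maxl k l))).
  by apply: (subsetPset _ _ (ndG _ _ (leq_maxr k l))).
move=> k; have [mF Fk] := Foo k; have [mG Gk] := Goo k; split.
  by rewrite -[X in measurable X]setTI; apply: mS => //; exact: measurableX.
rewrite /cons_measure /pushforward -comp_preimage.
rewrite (_ : split_tuple \o _ = id) ?preimage_id; last exact/funext.
by rewrite product_measure1E// lte_mul_pinfty// ge0_fin_numE.
Qed.

HB.instance Definition _ := Measure_isSigmaFinite.Build _ _ _ cons_measure
  cons_measure_sigma_finite.

End step.

(* Lebesgue measure on R^n as the n-fold product of the one-dimensional one;
   n.-tuple R carries the product sigma-algebra, i.e. the Borel sets of R^n. *)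
Fixpoint lebesgue_tuple n : {sigma_finite_measure set (n.-tuple R) -> \bar R} :=
  if n is m.+1 then cons_measure (lebesgue_tuple m)
  else \d_([tuple] : 0.-tuple R).

End LebesgueTuple.

Section EuclideanNorm.
Context {R : realType} {n : nat}.
Implicit Types x y z : 'rV[R]_n.

(* The library norm on 'rV[R]_n is the sup norm. *)
Definition enorm x : R := Num.sqrt (\sum_i x 0 i ^+ 2).

Lemma enorm_ge0 x : 0 <= enorm x.
Proof. exact: sqrtr_ge0. Qed.

Lemma sqr_enorm x : enorm x ^+ 2 = \sum_i x 0 i ^+ 2.
Proof. by rewrite sqr_sqrtr// sumr_ge0// => i _; exact: sqr_ge0. Qed.

Lemma enorm0 : enorm 0 = 0.
Proof. by rewrite /enorm big1 ?sqrtr0// => i _; rewrite mxE expr0n. Qed.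

Lemma enormN x : enorm (- x) = enorm x.
Proof. by congr Num.sqrt; apply: eq_bigr => i _; rewrite mxE sqrrN. Qed.

Lemma enormC x y : enorm (x - y) = enorm (y - x).
Proof. by rewrite -enormN opprB. Qed.

Lemma ler_coord_enorm x i : `|x 0 i| <= enorm x.
Proof.
rewrite -sqrtr_sqr ler_sqrt; last by rewrite sumr_ge0// => j _; exact: sqr_ge0.
by rewrite (bigD1 i)//= lerDl sumr_ge0// => j _; exact: sqr_ge0.
Qed.

Lemma ler_norm_enorm x : `|x| <= enorm x.
Proof.
rewrite [leLHS]/Num.norm/= mx_normrE; apply/bigmax_leP; split=> [|[i j] _ /=].
  exact: enorm_ge0.
by rewrite ord1; exact: ler_coord_enorm.
Qed.

Lemma ler_enorm_norm x : enorm x <= Num.sqrt n%:R * `|x|.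
Proof.
have xE : Num.sqrt (`|x| ^+ 2) = `|x| by rewrite sqrtr_sqr ger0_norm.
rewrite -xE -sqrtrM//; apply: ler_wsqrtr.
have -> : n%:R * `|x| ^+ 2 = \sum_(i < n) `|x| ^+ 2.
  by rewrite sumr_const card_ord mulr_natl.
apply: ler_sum => i _; rewrite -[leLHS]ger0_norm ?sqr_ge0// normrX.
rewrite lerXn2r ?nnegrE//.
rewrite [leRHS]/Num.norm/= mx_normrE; apply/bigmax_geP; right.
by exists (0, i).
Qed.

Lemma cauchy_schwarz x y : \sum_i x 0 i * y 0 i <= enorm x * enorm y.
Proof.
set p := \sum_i _; have [p0|p0] := leP p 0.
  by rewrite (le_trans p0)// mulr_ge0// enorm_ge0.
have q0 : 0 <= enorm x * enorm y by rewrite mulr_ge0// enorm_ge0.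
rewrite -(ler_pXn2r (n := 2))// ?nnegrE// ?(ltW p0)// exprMn !sqr_enorm.
have : 0 <= \sum_i \sum_j (x 0 i * y 0 j - x 0 j * y 0 i) ^+ 2.
  by apply: sumr_ge0 => i _; apply: sumr_ge0 => j _; exact: sqr_ge0.
set a := \sum_i x 0 i ^+ 2; set b := \sum_i y 0 i ^+ 2.
suff -> : \sum_i \sum_j (x 0 i * y 0 j - x 0 j * y 0 i) ^+ 2
          = (a * b - p ^+ 2) *+ 2.
  by rewrite (pmulrn_lge0 _ (ltn0Sn 1)) subr_ge0.
have E (u v : 'I_n -> R) :
    (\sum_i u i) * (\sum_i v i) = \sum_i \sum_j u i * v j.
  by rewrite big_distrl/=; apply: eq_bigr => i _; rewrite big_distrr.
have -> : (a * b - p ^+ 2) *+ 2 = a * b + b * a - (p * p + p * p) by ring.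
rewrite /a /b /p !E -!big_split/= -sumrB; apply: eq_bigr => i _.
by rewrite -!big_split/= -sumrB; apply: eq_bigr => j _; ring.
Qed.

Lemma enorm_triangle x y : enorm (x + y) <= enorm x + enorm y.
Proof.
rewrite -(ler_pXn2r (n := 2))// ?nnegrE ?addr_ge0 ?enorm_ge0//.
rewrite sqrrD !sqr_enorm -addrA [X in _ <= _ + X]addrC addrA.
have -> : \sum_i (x + y) 0 i ^+ 2 =
    \sum_i x 0 i ^+ 2 + \sum_i y 0 i ^+ 2 + (\sum_i x 0 i * y 0 i) *+ 2.
  rewrite -sumrMnl -!big_split/=; apply: eq_bigr => i _.
  by rewrite mxE sqrrD addrAC.
by rewrite lerD2l lerMn2r cauchy_schwarz orbT.
Qed.

Lemma enorm_distD y x z : enorm (x - z) <= enorm (x - y) + enorm (y - z).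
Proof. by rewrite -[x - z](subrKA y) enorm_triangle. Qed.

End EuclideanNorm.

Record convex_body (R : realType) (n : nat) := ConvexBody {
  body_set :> set 'rV[R]_n ;
  body_nonempty : body_set !=set0 ;
  body_convex : convex_set (M := 'rV[R]_n) body_set ;
  body_compact : compact body_set }.

Section ConvexBody.
Context {R : realType} {n : nat}.
Local Notation Kn := (convex_body R n).
Implicit Types K L M : Kn.

Lemma convex_body_eq K L : (K : set 'rV[R]_n) = L -> K = L.
Proof.
case: K L => K K1 K2 K3 [L L1 L2 L3] /= KL; case: _ / KL L1 L2 L3 => L1 L2 L3.
by congr ConvexBody; exact: Prop_irrelevance.
Qed.

Lemma body_closed K : closed (K : set 'rV[R]_n).
Proof.
by apply: compact_closed; [exact: norm_hausdorff | exact: body_compact].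
Qed.

(* The radii r such that K is contained in L + r B and L in K + r B, where B is
   the Euclidean unit ball. *)
Definition hausdorff_radii K L : set R := [set r | [/\ 0 <= r,
  forall x, body_set K x -> exists2 y, body_set L y & enorm (x - y) <= r &
  forall y, body_set L y -> exists2 x, body_set K x & enorm (x - y) <= r]].

Definition hausdorff_dist K L : R := inf (hausdorff_radii K L).

Lemma hausdorff_radii_lb K L : lbound (hausdorff_radii K L) 0.
Proof. by move=> r []. Qed.

Lemma body_enorm_bounded K : exists2 r, 0 <= r & forall x, body_set K x -> enorm x <= r.
Proof.
have /compact_bounded[M [_ KM]] := @body_compact _ _ K.
have M1 : M < `|M| + 1 by rewrite (le_lt_trans (ler_norm _))// ltrDl.
exists (Num.sqrt n%:R * (`|M| + 1)).
  by rewrite mulr_ge0// ?sqrtr_ge0// addr_ge0.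
move=> x Kx; rewrite (le_trans (ler_enorm_norm _))// ler_wpM2l ?sqrtr_ge0//.
exact: (KM _ M1).
Qed.

Lemma hausdorff_radii_nonempty K L : hausdorff_radii K L !=set0.
Proof.
have [r r0 Kr] := body_enorm_bounded K; have [s s0 Ls] := body_enorm_bounded L.
have [x Kx] := body_nonempty K; have [y Ly] := body_nonempty L.
exists (r + s); split; first exact: addr_ge0.
- move=> z Kz; exists y => //; rewrite (le_trans (enorm_triangle _ _))//.
  by rewrite enormN lerD ?Kr ?Ls.
- move=> z Lz; exists x => //; rewrite (le_trans (enorm_triangle _ _))//.
  by rewrite enormN lerD ?Kr ?Ls.
Qed.

Lemma hausdorff_radii_has_inf K L : has_inf (hausdorff_radii K L).
Proof.
by split; [exact: hausdorff_radii_nonempty |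
           exists 0; exact: hausdorff_radii_lb].
Qed.

Lemma hausdorff_dist_le K L r : hausdorff_radii K L r -> hausdorff_dist K L <= r.
Proof. by move=> ?; apply: ge_inf => //; exists 0; exact: hausdorff_radii_lb. Qed.

Lemma hausdorff_dist_ge0 K L : 0 <= hausdorff_dist K L.
Proof.
by apply: lb_le_inf; [exact: hausdorff_radii_nonempty |
                      exact: hausdorff_radii_lb].
Qed.

Lemma hausdorff_radiiC K L : hausdorff_radii K L = hausdorff_radii L K.
Proof.
suff H A B : hausdorff_radii A B `<=` hausdorff_radii B A.
  by apply/seteqP; split; exact: H.
move=> r [r0 AB BA]; split=> //.
- by move=> x /BA[y Ay xy]; exists y => //; rewrite enormC.
- by move=> x /AB[y By xy]; exists y => //; rewrite enormC.
Qed.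

Lemma hausdorff_distC K L : hausdorff_dist K L = hausdorff_dist L K.
Proof. by rewrite /hausdorff_dist hausdorff_radiiC. Qed.

Lemma hausdorff_distxx K : hausdorff_dist K K = 0.
Proof.
apply/eqP; rewrite eq_le hausdorff_dist_ge0 andbT hausdorff_dist_le//.
by split=> // x Kx; exists x; rewrite ?subrr ?enorm0.
Qed.

Lemma hausdorff_dist_triangle L K M :
  hausdorff_dist K M <= hausdorff_dist K L + hausdorff_dist L M.
Proof.
apply/ler_addgt0Pr => e e0; have e2 : 0 < e / 2 by rewrite divr_gt0.
have [r [r0 KL LK] rlt] := inf_adherent e2 (hausdorff_radii_has_inf K L).
have [s [s0 LM ML] slt] := inf_adherent e2 (hausdorff_radii_has_inf L M).
apply: (@le_trans _ _ (r + s)); last first.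
  by rewrite (splitr e) addrACA lerD// ltW.
apply: hausdorff_dist_le; split; first exact: addr_ge0.
- move=> x /KL[y Ly xy]; have [z Mz yz] := LM _ Ly; exists z => //.
  by rewrite (le_trans (enorm_distD y _ _))// lerD.
- move=> z /ML[y Ly yz]; have [x Kx xy] := LK _ Ly; exists x => //.
  by rewrite (le_trans (enorm_distD y _ _))// lerD.
Qed.

Lemma hausdorff_dist_eq0 K L : hausdorff_dist K L = 0 -> K = L.
Proof.
suff H A B : hausdorff_dist A B = 0 -> (A : set 'rV[R]_n) `<=` B.
  move=> KL; apply/convex_body_eq/seteqP; split; apply: H => //.
  by rewrite hausdorff_distC.
move=> AB0 x Ax; apply: body_closed => U /nbhs_ballP[e e0 xeU].
have [r [r0 AB _]] := inf_adherent e0 (hausdorff_radii_has_inf A B).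
rewrite -/(hausdorff_dist A B) AB0 add0r => re.
have [y By xy] := AB _ Ax; exists y; split => //; apply: xeU.
rewrite -ball_normE/=.
by rewrite (le_lt_trans (ler_norm_enorm _))// (le_lt_trans xy).
Qed.

(* Makes Kn a metric space, so that [continuous] on operators Kn -> Kn refers to
   the Hausdorff metric. *)
HB.instance Definition _ := gen_eqMixin Kn.
HB.instance Definition _ := gen_choiceMixin Kn.
HB.instance Definition _ := @isMetric.Build R Kn hausdorff_dist
  hausdorff_distxx hausdorff_dist_eq0 hausdorff_distC hausdorff_dist_triangle.

(* Vectors are rows, so the linear map of matrix g is x |-> x *m g. *)
Section LinearImage.
Variables (g : 'M[R]_n) (K : Kn).

Let img : set 'rV[R]_n := [set x *m g | x in K].

Let img_nonempty : img !=set0.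
Proof. by have [x Kx] := body_nonempty K; exists (x *m g), x. Qed.

Let img_convex : convex_set (M := 'rV[R]_n) img.
Proof.
move=> _ _ t /set_mem[x Kx <-] /set_mem[y Ky <-]; apply/mem_set.
exists (conv t (x : convex_lmodType 'rV[R]_n) y).
  by apply/set_mem/(@body_convex _ _ K); exact/mem_set.
by rewrite mulmxDl -!scalemxAl.
Qed.

Let img_compact : compact img.
Proof.
apply: continuous_compact; last exact: body_compact.
apply: continuous_subspaceT => x.
rewrite (_ : mulmx^~ g = fun y => \sum_i y 0 i *: row i g); last first.
  by apply/funext => y; rewrite mulmx_sum_row.
apply: cvg_big; [exact: add_continuous | exact: nbhs_filter |].
move=> i _; have xi : y 0 i @[y --> x] --> x 0 i by exact: coord_continuous.
exact: (cvgZr_tmp (a := row i g) xi).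
Qed.

Definition linear_image : Kn := ConvexBody img_nonempty img_convex img_compact.
End LinearImage.

Definition gl_covariant (D : Kn -> Kn) : Prop :=
  forall (K : Kn) (g : 'M[R]_n), g \in unitmx ->
    D (linear_image g K) = linear_image g (D K).

(* Convex bodies are compact, hence Borel, so [vol] is only used on sets that are
   measurable. *)
Definition vol (A : set 'rV[R]_n) : \bar R :=
  lebesgue_tuple n [set t : n.-tuple R | A (\row_i tnth t i)].

Definition rogers_shephard (D : Kn -> Kn) : Prop :=
  exists2 C : R, 0 < C & forall K : Kn, (vol (D K) <= C%:E * vol K)%E.

Definition minkowski_add (A B : set 'rV[R]_n) : set 'rV[R]_n :=
  [set x + y | x in A & y in B].

Definition dilate (c : R) (A : set 'rV[R]_n) : set 'rV[R]_n :=
  [set c *: x | x in A].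

Definition reflect_set (A : set 'rV[R]_n) : set 'rV[R]_n := [set - x | x in A].

End ConvexBody.

(* Main.v *)
(* Continuity and density of the invertible matrices give D (gK) = g (D K) for
   every matrix g. Projecting on lines, the support function of D K at u depends
   only on h_K(u) and h_K(-u): h_{DK}(u) = phi (h_K(u), -h_K(-u)), where phi is
   the support function of D [e_1, e_2] restricted to the plane of e_1 and e_2, a
   symmetric sublinear function. A simplex in an affine hyperplane off the origin
   has volume zero, so by the Rogers-Shephard inequality its image lies in a
   hyperplane, and phi has zero width in some direction. Either that forces zero
   width in the direction (1, 1), or phi vanishes at (1, -1), and then
   sublinearity of the support function of the image of the triangle
   conv (0, e_1, e_2) forces it as well. Hence phi is linear on p >= q, which is
   the formula. The converse needs a Rogers-Shephard inequality with any constant: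
   a frame of K with almost maximal determinant gives a small parallelepiped in K,
   a bounded number of whose translates cover aK + b(-K). This works whatever the
   dimension of K and uses only the translation invariance of the volume. *)

Require Import Defs.
From mathcomp Require Import all_boot all_order all_algebra.
From mathcomp Require Import all_classical all_reals all_analysis.
From mathcomp Require Import perm measurable_realfun.
From mathcomp Require Import ring lra.

Set Implicit Arguments.
Unset Strict Implicit.
Unset Printing Implicit Defensive.

Import Order.TTheory GRing.Theory Num.Theory.
Import numFieldNormedType.Exports.

Local Open Scope classical_set_scope.
Local Open Scope ring_scope.

(** * Support functions *)

Section Dot.
Context {R : realType} {n : nat}.
Implicit Types (x y u v : 'rV[R]_n) (a : R).

Definition dot x u : R := (x *m u^T) 0 0.

Lemma dotE x u : dot x u = \sum_i x 0 i * u 0 i.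
Proof. by rewrite /dot mxE; apply: eq_bigr => i _; rewrite mxE. Qed.

Lemma dotC x u : dot x u = dot u x.
Proof. by rewrite !dotE; apply: eq_bigr => i _; rewrite mulrC. Qed.

Lemma dotDl x y u : dot (x + y) u = dot x u + dot y u.
Proof. by rewrite /dot mulmxDl mxE. Qed.

Lemma dotZl a x u : dot (a *: x) u = a * dot x u.
Proof. by rewrite /dot -scalemxAl mxE. Qed.

Lemma dotNl x u : dot (- x) u = - dot x u.
Proof. by rewrite -scaleN1r dotZl mulN1r. Qed.

Lemma dotBl x y u : dot (x - y) u = dot x u - dot y u.
Proof. by rewrite dotDl dotNl. Qed.

Lemma dotDr x u v : dot x (u + v) = dot x u + dot x v.
Proof. by rewrite dotC dotDl !(dotC x). Qed.

Lemma dotZr a x u : dot x (a *: u) = a * dot x u.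
Proof. by rewrite dotC dotZl (dotC x). Qed.

Lemma dotNr x u : dot x (- u) = - dot x u.
Proof. by rewrite dotC dotNl (dotC x). Qed.

Lemma dotBr x u v : dot x (u - v) = dot x u - dot x v.
Proof. by rewrite dotDr dotNr. Qed.

Lemma dotxx_ge0 x : 0 <= dot x x.
Proof. by rewrite dotE sumr_ge0// => i _; exact: sqr_ge0. Qed.

Lemma dotxx_eq0 x : dot x x = 0 -> x = 0.
Proof.
rewrite dotE => /eqP; rewrite psumr_eq0 => [/allP xx0|i _]; last exact: sqr_ge0.
apply/rowP => i; rewrite mxE; apply/eqP.
by have := xx0 i (mem_index_enum _); rewrite mulf_eq0 orbb.
Qed.

Lemma dot_continuous u : continuous (dot^~ u).
Proof.
rewrite (_ : dot^~ u = fun x => \sum_i x 0 i * u 0 i); last first.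
  by apply/funext => x; rewrite dotE.
move=> x; apply: cvg_big; [exact: add_continuous | exact: nbhs_filter |].
move=> i _; have xi : (fun y : 'rV[R]_n => y 0 i) @ x --> x 0 i.
  exact: coord_continuous.
exact: (cvgMr_tmp (b := u 0 i) xi).
Qed.

End Dot.

Lemma mulmx_continuous {R : realType} {m n : nat} (g : 'M[R]_(m, n)) :
  continuous (fun x : 'rV[R]_m => x *m g).
Proof.
move=> x.
rewrite (_ : mulmx^~ g = fun y => \sum_i y 0 i *: row i g); last first.
  by apply/funext => y; rewrite mulmx_sum_row.
apply: cvg_big; [exact: add_continuous | exact: nbhs_filter |].
move=> i _; have xi : (fun y : 'rV[R]_m => y 0 i) @ x --> x 0 i.
  exact: coord_continuous.
exact: (cvgZr_tmp (a := row i g) xi).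
Qed.

Section Support.
Context {R : realType} {n : nat}.
Implicit Types (x y u v : 'rV[R]_n) (K L : convex_body R n) (a b t : R).

Lemma convex_setP (A : set 'rV[R]_n) :
  convex_set (M := 'rV[R]_n) A <->
  forall x y t, 0 <= t -> t <= 1 -> A x -> A y -> A (t *: x + (1 - t) *: y).
Proof.
split=> [cA x y t t0 t1 Ax Ay|cA x y t /set_mem Ax /set_mem Ay].
  by have /set_mem := cA x y (Itv01 t0 t1) (mem_set Ax) (mem_set Ay).
by apply/mem_set; exact: cA.
Qed.

Definition support K u : R := sup [set dot x u | x in body_set K].

Let compact_dot K u : compact [set dot x u | x in body_set K].
Proof.
apply: continuous_compact; last exact: body_compact.
by apply: continuous_subspaceT => x; exact: dot_continuous.
Qed.

Let has_sup_dot K u : has_sup [set dot x u | x in body_set K].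
Proof.
apply: compact_has_sup; last exact: compact_dot.
by have [x Kx] := body_nonempty K; exists (dot x u), x.
Qed.

Lemma support_ub K u x : body_set K x -> dot x u <= support K u.
Proof. by move=> Kx; apply: sup_upper_bound; [exact: has_sup_dot|exists x]. Qed.

Lemma support_le K u a :
  (forall x, body_set K x -> dot x u <= a) -> support K u <= a.
Proof.
move=> Ka; apply: ge_sup; first by case: (has_sup_dot K u).
by move=> _ [x Kx <-]; exact: Ka.
Qed.

Lemma support_max K u : exists2 x, body_set K x & dot x u = support K u.
Proof.
have [| |x Kx xM] := @compact_EVT_max _ _ (dot^~ u) (body_set K) _
  (@body_compact _ _ K).
- exact: body_nonempty.
- by apply: continuous_subspaceT => x; exact: dot_continuous.
exists x; first exact/set_mem; apply/le_anti; rewrite support_ub ?support_le//.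
  by move=> y /mem_set; exact: xM.
exact/set_mem.
Qed.

Lemma support_lb K u x : body_set K x -> - support K (- u) <= dot x u.
Proof. by move=> Kx; rewrite lerNl -dotNr support_ub. Qed.

Lemma supportD K u v : support K (u + v) <= support K u + support K v.
Proof. by apply: support_le => x Kx; rewrite dotDr lerD ?support_ub. Qed.

Lemma supportZ K a u : 0 <= a -> support K (a *: u) = a * support K u.
Proof.
move=> a0; apply/le_anti/andP; split.
  by apply: support_le => x Kx; rewrite dotZr ler_wpM2l ?support_ub.
by have [x Kx <-] := support_max K u; rewrite -dotZr support_ub.
Qed.

Lemma support_gap K u : - support K (- u) <= support K u.
Proof.
have [x Kx] := body_nonempty K.
by rewrite (le_trans (support_lb u Kx))// support_ub.
Qed.

(** The separating vector is [x - p], with [p] the point of [K] nearest to [x]. If some [y] in [K]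
    had a larger product with it than [p], moving from [p] a little towards [y] would come closer to
    [x]. *)
Lemma support_separation K x :
  ~ body_set K x -> exists u, support K u < dot x u.
Proof.
move=> Kx; pose f y := dot (y - x) (y - x).
have [| |p /set_mem Kp pmin] := @compact_EVT_min _ _ f (body_set K) _
  (@body_compact _ _ K).
- exact: body_nonempty.
- apply: continuous_subspaceT => y.
  rewrite (_ : f = fun y => \sum_i (y - x) 0 i * (y - x) 0 i); last first.
    by apply/funext => z; rewrite /f dotE.
  apply: cvg_big; [exact: add_continuous | exact: nbhs_filter |].
  move=> i _; have yi : (fun z : 'rV[R]_n => z 0 i) @ y --> y 0 i.
    exact: coord_continuous.
  have : (fun z : 'rV[R]_n => (z - x) 0 i) @ y --> (y - x) 0 i.
    rewrite (_ : (fun z => _) = fun z : 'rV[R]_n => z 0 i - x 0 i).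
      by rewrite !mxE; apply: (cvgB yi (cvg_cst _)).
    by apply/funext => z; rewrite !mxE.
  by move=> h; exact: (cvgM h h).
have u0 : 0 < dot (x - p) (x - p).
  rewrite lt_neqAle dotxx_ge0 andbT eq_sym; apply/eqP => /dotxx_eq0/eqP.
  by rewrite subr_eq0 => /eqP xp; apply: Kx; rewrite xp.
exists (x - p); apply: (@le_lt_trans _ _ (dot p (x - p))); last first.
  by rewrite -subr_gt0 -dotBl.
apply: support_le => y Ky; rewrite -subr_le0 -dotBl.
rewrite leNgt; apply/negP => yp.
set s := dot (y - p) (x - p) in yp; set q := dot (y - p) (y - p).
have q0 : 0 <= q := dotxx_ge0 _.
pose t := s / (s + q).
have sq : 0 < s + q by rewrite ltr_wpDr.
have t0 : 0 < t by rewrite divr_gt0.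
have t1 : t <= 1 by rewrite ler_pdivrMr// mul1r lerDl.
have tq : t * q < 2 * s.
  rewrite mulrAC ltr_pdivrMr// mulrDr; nra.
have /pmin : t *: y + (1 - t) *: p \in body_set K.
  by apply/mem_set/(convex_setP _).1 => //; [exact: body_convex | exact: ltW].
have fE v w : dot (v - w) (v - w) = dot v v - 2 * dot v w + dot w w.
  by rewrite dotBl !dotBr (dotC w v); ring.
have -> : f p = dot (x - p) (x - p) by rewrite /f -(opprB x p) dotNl dotNr opprK.
rewrite /f (_ : t *: y + (1 - t) *: p - x = t *: (y - p) - (x - p)); last first.
  by apply/rowP => i; rewrite !mxE; ring.
rewrite [leRHS]fE !dotZl dotZr -/q -/s.
have : 0 < t * (2 * s - t * q) by rewrite mulr_gt0// subr_gt0.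
nra.
Qed.

End Support.

(** * Construction of polytopes and of the bodies aK + b(-K) *)

Section Bodies.
Context {R : realType} {n : nat}.
Implicit Types (K L : convex_body R n).

Lemma convex_set_sum (A : set 'rV[R]_n) m (c : 'I_m -> R) (p : 'I_m -> 'rV[R]_n) :
  convex_set (M := 'rV[R]_n) A -> (forall i, 0 <= c i) -> \sum_i c i = 1 ->
  (forall i, A (p i)) -> A (\sum_i c i *: p i).
Proof.
move=> /convex_setP cA; elim: m => [|m IH] in c p *.
  by move=> _; rewrite big_ord0 => /esym/eqP; rewrite oner_eq0.
rewrite !big_ord_recl => c0 cS Ap.
set s := \sum_(i < m) c (lift ord0 i) in cS *.
have cE : c ord0 = 1 - s by rewrite -cS addrK.
have s0 : 0 <= s by rewrite sumr_ge0.
have s1 : s <= 1 by rewrite -subr_ge0 -cE.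
(* The tail weights can be normalised only if their sum [s] is nonzero; if it is zero, they all
   vanish. *)
have [sz|sN0] := eqVneq s 0.
  rewrite cE sz subr0 scale1r big1 ?addr0// => i _.
  move/eqP: sz; rewrite psumr_eq0// => /allP/(_ i (mem_index_enum _))/= /eqP ->.
  by rewrite scale0r.
rewrite cE addrC.
rewrite (_ : \sum_(i < m) _ = s *: \sum_i (c (lift ord0 i) / s) *: p (lift ord0 i)).
  by apply: cA => //; apply: IH => [i||i]; rewrite ?divr_ge0// -mulr_suml divff.
rewrite scaler_sumr; apply: eq_bigr => i _.
by rewrite scalerA mulrCA divff ?mulr1.
Qed.

Section Polytope.
Variables (m : nat) (P : 'M[R]_(m.+1, n)).

(** The standard simplex. The hull of the rows of [P] is its image under a linear map, so
    compactness and convexity carry over; having at least one row makes it nonempty. *)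
Let weights : set 'rV[R]_m.+1 :=
  [set c | (forall i, 0 <= c 0 i) /\ \sum_i c 0 i = 1].

Let weights_compact : compact weights.
Proof.
have cB : compact [set v : 'rV[R]_m.+1 | forall i, v ord0 i \in `[0, 1]].
  apply: (@rV_compact _ _ (fun=> `[(0 : R), 1]%classic)) => _.
  exact: segment_compact.
rewrite (_ : weights = [set v : 'rV[R]_m.+1 | forall i, v ord0 i \in `[0, 1]]
    `&` (dot^~ (const_mx 1) @^-1` [set 1])).
  apply: compact_closedI => //; apply: closed_comp => [x _|].
    exact: dot_continuous.
  exact: closed_eq.
have dE c : dot c (const_mx 1) = \sum_i c 0 i.
  by rewrite dotE; apply: eq_bigr => i _; rewrite mxE mulr1.
apply/seteqP; split=> c /=; rewrite dE => -[c0 cS]; split=> // i.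
  rewrite in_itv/= c0/= -cS (bigD1 i)//= lerDl.
  by rewrite sumr_ge0.
by have := c0 i; rewrite in_itv/= => /andP[].
Qed.

Let hull : set 'rV[R]_n := [set c *m P | c in weights].

Let hull_nonempty : hull !=set0.
Proof.
exists (row 0 P), (delta_mx 0 0); last by rewrite -rowE.
split=> [i|]; first by rewrite mxE ler0n.
rewrite (bigD1 0)//= mxE !eqxx big1 ?addr0// => i i0.
by rewrite mxE (negPf i0) andbF.
Qed.

Let hull_convex : convex_set (M := 'rV[R]_n) hull.
Proof.
apply/convex_setP => _ _ t t0 t1 [c [c0 cS] <-] [d [d0 dS] <-].
exists (t *: c + (1 - t) *: d); last by rewrite mulmxDl -!scalemxAl.
split=> [i|]; first by rewrite !mxE addr_ge0// mulr_ge0// subr_ge0.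
under eq_bigr do rewrite !mxE.
by rewrite big_split/= -!mulr_sumr cS dS !mulr1 addrC subrK.
Qed.

Let hull_compact : compact hull.
Proof.
apply: continuous_compact => //; apply: continuous_subspaceT.
exact: mulmx_continuous.
Qed.

Definition polytope : convex_body R n :=
  ConvexBody hull_nonempty hull_convex hull_compact.

Lemma polytope_row i : body_set polytope (row i P).
Proof.
exists (delta_mx 0 i); last by rewrite -rowE.
split=> [j|]; first by rewrite mxE ler0n.
rewrite (bigD1 i)//= mxE !eqxx big1 ?addr0// => j ji.
by rewrite mxE (negPf ji) andbF.
Qed.

Lemma polytope_dot_le u b :
  (forall i, dot (row i P) u <= b) ->
  forall x, body_set polytope x -> dot x u <= b.
Proof.
move=> Pb _ [c [c0 cS] <-]; rewrite mulmx_sum_row.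
rewrite /dot mulmx_suml summxE -[b]mul1r -cS mulr_suml.
by apply: ler_sum => i _; rewrite -scalemxAl mxE ler_wpM2l ?Pb.
Qed.

Lemma support_polytope u i :
  (forall j, dot (row j P) u <= dot (row i P) u) ->
  support polytope u = dot (row i P) u.
Proof.
move=> iM; apply/le_anti; rewrite support_ub ?andbT; last exact: polytope_row.
by apply: support_le; exact: polytope_dot_le.
Qed.

End Polytope.

Section Combination.
Variables (a b : R) (K : convex_body R n).

Let comb : set 'rV[R]_n :=
  minkowski_add (dilate a K) (dilate b (reflect_set K)).

(** As the image of the product of [K] with itself under one continuous linear map, the set is
    visibly convex and compact. *)
Let combE : comb =
  [set a *: z.1 - b *: z.2 | z in body_set K `*` body_set K].
Proof.
apply/seteqP; split.
  move=> _ [_ [x Kx <-] [_ [_ [y Ky <-] <-] <-]].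
  by exists (x, y); rewrite //= scalerN.
move=> _ [[x y] [Kx Ky] <-]; exists (a *: x); first by exists x.
exists (- (b *: y)) => //; rewrite -scalerN.
by exists (- y) => //; exists y.
Qed.

Let comb_nonempty : comb !=set0.
Proof.
rewrite combE; have [x Kx] := body_nonempty K.
by exists (a *: x - b *: x), (x, x).
Qed.

Let comb_convex : convex_set (M := 'rV[R]_n) comb.
Proof.
have /convex_setP cK := @body_convex _ _ K.
rewrite combE; apply/convex_setP.
move=> _ _ t t0 t1 [[x1 x2] [Kx1 Kx2] <-] [[y1 y2] [Ky1 Ky2] <-].
exists (t *: x1 + (1 - t) *: y1, t *: x2 + (1 - t) *: y2).
  by split; exact: cK.
by apply/rowP => i; rewrite /= !mxE; ring.
Qed.

Let comb_compact : compact comb.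
Proof.
rewrite combE; apply: continuous_compact; last first.
  by apply: compact_setX; exact: body_compact.
apply: continuous_subspaceT => z.
apply: cvgB; apply: cvgZl_tmp; [exact: cvg_fst | exact: cvg_snd].
Qed.

Definition combination : convex_body R n :=
  ConvexBody comb_nonempty comb_convex comb_compact.

Lemma combinationP z : body_set combination z <->
  exists x y, [/\ body_set K x, body_set K y & z = a *: x - b *: y].
Proof.
rewrite /= combE; split=> [[[x y] [Kx Ky] <-]|[x [y [Kx Ky ->]]]].
  by exists x, y.
by exists (x, y).
Qed.

Lemma support_combination u : 0 <= a -> 0 <= b ->
  support combination u = a * support K u + b * support K (- u).
Proof.
move=> a0 b0; apply/le_anti/andP; split.
  apply: support_le => _ /combinationP[x [y [Kx Ky ->]]].
  by rewrite dotBl !dotZl -mulrN -dotNr lerD// ler_wpM2l ?support_ub.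
have [x Kx <-] := support_max K u; have [y Ky <-] := support_max K (- u).
rewrite -!dotZl dotNr -dotBl.
by apply: support_ub; apply/combinationP; exists x, y.
Qed.

End Combination.

Lemma support_inj K L : (forall u, support K u = support L u) -> K = L.
Proof.
suff H (A B : convex_body R n) : (forall u, support A u = support B u) ->
    body_set A `<=` body_set B.
  by move=> KL; apply/convex_body_eq/seteqP; split; exact: H.
move=> AB x Ax; apply: contrapT => nBx.
have [u] := support_separation nBx.
by rewrite -AB ltNge support_ub.
Qed.

End Bodies.

(** * Volume *)

Section Translation.
Context {R : realType}.

(** The translated measure has the right values on half-open intervals, and these determine Lebesgue
    measure. *)
Lemma lebesgue_measure_translate (a : R) (A : set R) : measurable A ->
  lebesgue_measure ((fun x => x + a) @^-1` A) = lebesgue_measure A.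
Proof.
move=> mA.
have mf : measurable_fun setT ((fun x => x + a) : measurableTypeR R -> measurableTypeR R).
  exact: measurable_funD.
apply/esym/(@lebesgue_measure_unique R
  (pushforward lebesgue_measure ((fun x => x + a) : _ -> measurableTypeR R)))
  => //= _ [[b c]] _ <-.
rewrite /pushforward/= (_ : _ @^-1` _ = `](b - a), (c - a)]%classic).
  rewrite !lebesgue_measure_itv/= !lte_fin ltrD2r.
  by rewrite -!EFinB opprB addrA subrK.
by apply/seteqP; split => x /=; rewrite !in_itv/= ltrBlDr lerBrDr.
Qed.

End Translation.

Section TupleMeasure.
Context {R : realType}.

Definition shift_tuple n (p t : n.-tuple R) : n.-tuple R :=
  [tuple tnth t i + tnth p i | i < n].

Lemma measurable_shift_tuple n (p : n.-tuple R) :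
  measurable_fun setT (shift_tuple p).
Proof.
apply/measurable_fun_tnthP => i.
rewrite (_ : _ \o _ = fun t : n.-tuple R => tnth t i + tnth p i).
  by apply: measurable_funD => //; exact: measurable_tnth.
by apply/funext => t; rewrite /= tnth_mktuple.
Qed.

(** Induction on the dimension: a translation acts on head and tail separately, and a product
    measure is determined by its values on rectangles. *)
Lemma lebesgue_tuple_translate n (p : n.-tuple R) (A : set (n.-tuple R)) :
  measurable A -> lebesgue_tuple n (shift_tuple p @^-1` A) = lebesgue_tuple n A.
Proof.
elim: n => [|n IH] in p A *.
  move=> _; congr (lebesgue_tuple 0 _); apply/seteqP.
  by split=> t; rewrite /= (tuple0 t) (tuple0 (shift_tuple _ _)).
move=> mA; rewrite /= /cons_measure /pushforward.
set B := @cons_pair R n @^-1` A.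
have mB : measurable B.
  by rewrite -[X in measurable X]setTI; exact: measurable_cons_pair.
pose g (z : measurableTypeR R * n.-tuple R) : measurableTypeR R * n.-tuple R :=
  (z.1 + thead p, shift_tuple [tuple of behead p] z.2).
have mg : measurable_fun setT g.
  apply/measurable_fun_pairP; split.
    by apply: measurable_funD => //; exact: measurable_fst.
  exact: (measurableT_comp (measurable_shift_tuple _) measurable_snd).
rewrite (_ : _ @^-1` _ = g @^-1` B); last first.
  have E z : shift_tuple p (cons_pair z) = cons_pair (g z).
    apply: eq_from_tnth => i; rewrite tnth_mktuple.
    case: (unliftP ord0 i) => [j ->|->]; last by rewrite /thead !tnth0.
    rewrite !tnthS tnth_mktuple tnth_behead (_ : inord _ = lift ord0 j)//.
    by apply/val_inj; rewrite /= inordK// ltnS.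
  by apply/seteqP; split => z; rewrite /B /= E.
rewrite -[LHS]/(pushforward (lebesgue_measure \x lebesgue_tuple n)%E g B).
apply/esym/product_measure_unique => //= X Y mX mY.
have mX' : measurable ((fun x : measurableTypeR R => x + thead p) @^-1` X).
  rewrite -[X in measurable X]setTI.
  by apply: (measurable_funD (f := fun x : measurableTypeR R => x)).
have mY' : measurable (shift_tuple [tuple of behead p] @^-1` Y).
  by rewrite -[X in measurable X]setTI; exact: measurable_shift_tuple.
rewrite /pushforward (_ : g @^-1` _ =
  ((fun x => x + thead p) @^-1` X) `*` (shift_tuple [tuple of behead p] @^-1` Y)).
  rewrite product_measure1E// IH//; congr (_ * _)%E.
  exact: lebesgue_measure_translate.
by apply/seteqP; split.
Qed.

(** Passes from row vectors to tuples, where the sigma-algebra lives: [vol A] is the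
    [lebesgue_tuple] measure of this set. *)
Definition tuple_set n (A : set 'rV[R]_n) : set (n.-tuple R) :=
  [set t | A (\row_i tnth t i)].

(** An open set is the union of the countably many boxes with rational centre and radius 1/(k+1)
    that it contains; [F] replaces the other boxes by the empty set. *)
Lemma measurable_open_tuple n (U : set 'rV[R]_n) :
  open U -> measurable (tuple_set U).
Proof.
move=> oU.
pose box (c : n.-tuple rat * nat) : set (n.-tuple R) :=
  [set t | forall i, `|tnth t i - ratr (tnth c.1 i)| < c.2.+1%:R^-1].
pose F c := if pselect (box c `<=` tuple_set U) then box c else set0.
have mbox c : measurable (box c).
  rewrite (_ : box c = \bigcap_(i in [set: 'I_n])
    ((fun t => tnth t i) @^-1` ball (ratr (tnth c.1 i) : R) c.2.+1%:R^-1)).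
    apply: fin_bigcap_measurable => // i _.
    rewrite -[X in measurable X]setTI; apply: measurable_tnth => //.
    exact: measurable_ball.
  apply/seteqP; split=> t tc i.
    by move=> _; rewrite /= -ball_normE /= distrC; exact: tc.
  by have := tc i I; rewrite /= -ball_normE /= distrC.
rewrite (_ : tuple_set U = \bigcup_c F c).
  apply: countable_bigcupT_measurable => // c.
  by rewrite /F; case: pselect => ? /=; [exact: mbox | exact: measurable0].
apply/seteqP; split=> [t Ut|t [c _]]; last first.
  by rewrite /F; case: pselect => //= cU; exact: cU.
have /nbhs_ballP[e /= e0 eU] : nbhs (\row_i tnth t i) U.
  by apply: open_nbhs_nbhs; split.
(* A box of radius below [e / 2] whose centre is within that radius of [t] stays in the [e]-ball
   around [t]. *)
have e2 : 0 < e / 2 by rewrite divr_gt0.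
have [k _ /(_ _ (leqnn k)) ke] := near_infty_natSinv_lt (PosNum e2).
have k0 : 0 < k.+1%:R^-1 :> R by rewrite invr_gt0.
have Q i : exists q : rat, `|tnth t i - ratr q| < k.+1%:R^-1.
  have [|q] := @rat_in_itvoo R (tnth t i) (tnth t i + k.+1%:R^-1).
    by rewrite ltrDl.
  rewrite in_itv/= => /andP[tq qt]; exists q.
  by rewrite distrC ger0_norm ?subr_ge0 ?(ltW tq)// ltrBlDl.
pose c : n.-tuple rat := [tuple projT1 (cid (Q i)) | i < n].
have ct : box (c, k) t.
  by move=> i; rewrite /= tnth_mktuple; exact: projT2 (cid (Q i)).
exists (c, k) => //; rewrite /F; case: pselect => // -[]; move=> s cs.
apply: eU; split => // i j; rewrite !mxE /ball /=.
apply: (@lt_trans _ _ (k.+1%:R^-1 + k.+1%:R^-1)); last first.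
  by rewrite [ltRHS]splitr ltrD.
rewrite -(subrKA (ratr (tnth c j))) (le_lt_trans (ler_normD _ _))// ltrD//.
by rewrite distrC; exact: cs.
Qed.

Lemma measurable_closed_tuple n (A : set 'rV[R]_n) :
  closed A -> measurable (tuple_set A).
Proof.
move=> /closed_openC/measurable_open_tuple mA.
rewrite (_ : tuple_set A = ~` tuple_set (~` A)); first exact: measurableC.
by rewrite /tuple_set; apply/seteqP; split => t /=; rewrite notE.
Qed.

End TupleMeasure.

Section Volume.
Context {R : realType} {n : nat}.
Implicit Types (K M : convex_body R n) (x : 'rV[R]_n) (A : set 'rV[R]_n).

Lemma measurable_body K : measurable (tuple_set K).
Proof. by apply: measurable_closed_tuple; exact: body_closed. Qed.

Lemma tuple_set_translate A (p : 'rV[R]_n) :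
  tuple_set [set x | A (x - p)] =
  shift_tuple [tuple - p 0 i | i < n] @^-1` tuple_set A.
Proof.
rewrite /tuple_set; apply/seteqP; split => t /=;
  set u := (X in A X) => Au; set v := (X in A X); rewrite (_ : v = u)//;
  by apply/rowP => i; rewrite /u /v !mxE !tnth_mktuple.
Qed.

Lemma measurable_translate K (p : 'rV[R]_n) :
  measurable (tuple_set [set x | body_set K (x - p)]).
Proof.
rewrite tuple_set_translate -[X in measurable X]setTI.
by apply: measurable_shift_tuple => //; exact: measurable_body.
Qed.

Lemma vol_translate K (p : 'rV[R]_n) :
  vol [set x | body_set K (x - p)] = vol K.
Proof.
rewrite /vol -![mkset _]/(tuple_set _) tuple_set_translate.
by apply: lebesgue_tuple_translate; exact: measurable_body.
Qed.

Lemma measure_bigsetU_le d (T : measurableType d) (mu : {measure set T -> \bar R})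
    (I : Type) (s : seq I) (F : I -> set T) :
  (forall i, measurable (F i)) ->
  (mu (\big[setU/set0]_(i <- s) F i) <= \sum_(i <- s) mu (F i))%E.
Proof.
move=> mF; elim: s => [|i s IH]; first by rewrite !big_nil measure0.
rewrite !big_cons; apply: le_trans (measureU2 mu _ _) _ => //.
  exact: bigsetU_measurable.
exact: leeD.
Qed.

(* The translates of K placed at a grid of mesh 1/(m+1) cover M: each coordinate
   is the sum of a grid point and a remainder in [0, 1/(m+1)]. *)
Lemma vol_cover K M r (Y : 'M[R]_(r, n)) (p q : 'rV[R]_n) (m c : nat) :
  (forall l : 'rV[R]_r, (forall i, 0 <= l 0 i <= m.+1%:R^-1) ->
     body_set K (p + l *m Y)) ->
  (forall x, body_set M x -> exists2 l : 'rV[R]_r,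
     x = q + l *m Y & forall i, `|l 0 i| <= c%:R) ->
  (vol M <= ((c.*2 * m.+1).+1 ^ r)%:R%:E * vol K)%E.
Proof.
(* Coordinates fill [-c, c], of length 2c, so mesh 1/(m+1) takes [N.+1] grid points j/(m+1) - c in
   each of the [r] directions. *)
move=> YK MY; set N := (c.*2 * m.+1)%N.
pose w (j : {ffun 'I_r -> 'I_N.+1}) : 'rV[R]_n :=
  q - p + (\row_i ((j i)%:R / m.+1%:R - c%:R)) *m Y.
pose F j := tuple_set [set x | body_set K (x - w j)].
have mF j : measurable (F j) by exact: measurable_translate.
have MF : tuple_set M `<=` \big[setU/set0]_(j : {ffun 'I_r -> 'I_N.+1}) F j.
  move=> t /MY[l tE lc]; rewrite -bigcup_seq /=.
  have lc0 i : 0 <= (l 0 i + c%:R) * m.+1%:R.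
    rewrite mulr_ge0// -lerBlDr sub0r.
    by have := lc i; rewrite ler_norml => /andP[].
  have jN i : (Num.truncn ((l 0 i + c%:R) * m.+1%:R)%R < N.+1)%N.
    rewrite ltnS -(ler_nat R).
    apply: (@le_trans _ _ ((l 0 i + c%:R) * m.+1%:R)); first by rewrite truncn_le.
    rewrite natrM ler_wpM2r// -addnn natrD lerD2r.
    by have := lc i; rewrite ler_norml => /andP[].
  pose j : {ffun 'I_r -> 'I_N.+1} := [ffun i => Ordinal (jN i)].
  exists j; first by rewrite /= mem_index_enum.
  rewrite /F /tuple_set /= tE.
  pose mu := \row_i (l 0 i + c%:R - (j i)%:R / m.+1%:R).
  rewrite (_ : q + l *m Y - w j = p + mu *m Y).
    apply: YK => i; rewrite mxE ffunE /=.
    have /andP[h1 h2] := truncn_itv (lc0 i).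
    have m0 : 0 < m.+1%:R :> R by [].
    rewrite subr_ge0 ler_pdivrMr// h1/= lerBlDr.
    rewrite -(ler_pM2r m0) [leRHS]mulrDl mulVf ?gt_eqF// divfK ?gt_eqF//.
    by rewrite [leRHS]addrC natr1 ltW.
  rewrite /w (_ : l = \row_i ((j i)%:R / m.+1%:R - c%:R) + mu).
    by rewrite mulmxDl; apply/rowP => k; rewrite !mxE; ring.
  by apply/rowP => k; rewrite !mxE; ring.
apply: (@le_trans _ _ (\sum_(j : {ffun 'I_r -> 'I_N.+1}) lebesgue_tuple n (F j))%E).
  apply: le_trans (measure_bigsetU_le _ _ mF).
  apply: le_measure; rewrite ?inE//; first exact: measurable_body.
  exact: bigsetU_measurable.
rewrite (eq_bigr (fun=> vol K)); last by move=> j _; exact: vol_translate.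
rewrite sumr_const card_ffun !card_ord.
by rewrite mule_natl.
Qed.

(** A reference body of positive volume: a body with finitely many translates covering it cannot
    have volume zero. *)
Let unit_box : set 'rV[R]_n := [set x | forall i, x 0 i \in `[0, 1]].

Let unit_box_nonempty : unit_box !=set0.
Proof. by exists 0 => i; rewrite mxE in_itv/= lexx ler01. Qed.

Let unit_box_convex : convex_set (M := 'rV[R]_n) unit_box.
Proof.
apply/convex_setP => x y t t0 t1 x01 y01 i.
have := x01 i; have := y01 i; rewrite !in_itv/= !mxE => /andP[y0 y1] /andP[x0 x1].
apply/andP; split; nra.
Qed.

Let unit_box_compact : compact unit_box.
Proof.
apply: (@rV_compact _ _ (fun=> `[(0 : R), 1]%classic)) => _.
exact: segment_compact.
Qed.

Definition unit_cube : convex_body R n :=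
  ConvexBody unit_box_nonempty unit_box_convex unit_box_compact.

Lemma unit_cubeP x : body_set unit_cube x <-> forall i, x 0 i \in `[0, 1].
Proof. by []. Qed.

Lemma tuple_set_unit_cube :
  tuple_set unit_cube = [set t : n.-tuple R | forall i, tnth t i \in `[0, 1]].
Proof.
rewrite /tuple_set; apply/seteqP; split => t.
  by move=> /= /unit_cubeP tc i; have := tc i; rewrite mxE.
by move=> /= tc; apply/unit_cubeP => i; rewrite mxE.
Qed.

End Volume.

Lemma vol_unit_cube (R : realType) n : vol (@unit_cube R n) = 1%E.
Proof.
rewrite /vol -[mkset _]/(tuple_set _) tuple_set_unit_cube.
elim: n => [|n IH].
  by rewrite /= diracE mem_set// => -[].
rewrite /= /cons_measure /pushforward.
  rewrite (_ : _ @^-1` _ =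
     `[0, 1]%classic `*` [set t : n.-tuple R | forall i, tnth t i \in `[0, 1]]).
    rewrite product_measure1E//; last first.
      by rewrite -tuple_set_unit_cube; exact: measurable_body.
    rewrite IH mule1; transitivity (@lebesgue_measure R `[0, 1]%classic) => //.
    by rewrite lebesgue_measure_itv/= lte_fin ltr01 oppr0 adde0.
  apply/seteqP; split => -[x t] /=.
    move=> xt; split; first by have := xt ord0; rewrite tnth0.
    by move=> i; have := xt (lift ord0 i); rewrite tnthS.
  move=> [x01 t01] i; case: (unliftP ord0 i) => [j ->|->].
    by rewrite tnthS.
  by rewrite tnth0.
Qed.

Lemma vol_hyperplane0 (R : realType) n (K : convex_body R n.+1) (a : R) :
  (forall x, body_set K x -> x 0 0 = a) -> vol K = 0%E.
Proof.
move=> Ka; apply/eqP; rewrite eq_le measure_ge0 andbT.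
have mH : measurable (@tnth _ R ^~ ord0 @^-1` [set a] : set (n.+1.-tuple R)).
  by rewrite -[X in measurable X]setTI; exact: measurable_tnth.
apply: (@le_trans _ _
    (lebesgue_tuple n.+1 (@tnth _ R ^~ ord0 @^-1` [set a]))).
  apply: le_measure; rewrite ?inE//; first exact: measurable_body.
  by move=> t /Ka; rewrite mxE.
rewrite /= /cons_measure /pushforward.
rewrite (_ : _ @^-1` _ = [set a] `*` setT); last first.
  by apply/seteqP; split => -[x t] /=; rewrite tnth0 // => -[].
(* The second factor may have infinite measure; zero times infinity is zero in the extended
   reals. *)
by rewrite product_measure1E// [X in (X * _)%E](lebesgue_measure_set1 a) mul0e.
Qed.

(** * Frames of nearly maximal determinant *)

Section Frame.
Context {R : realType} {n : nat}.
Implicit Types (K : convex_body R n).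

(** A crude bound from the Leibniz formula; it serves to make the supremum of the frame determinants
    finite. *)
Lemma ler_norm_det r (A : 'M[R]_r) (b : R) :
  (forall i j, `|A i j| <= b) -> `|\det A| <= \sum_(s : 'S_r) b ^+ r.
Proof.
move=> Ab; rewrite /determinant; apply: le_trans (ler_norm_sum _ _ _) _.
apply: ler_sum => s _; rewrite normrM normrX normrN1 expr1n mul1r.
rewrite normr_prod -[in leRHS](card_ord r) -prodr_const.
by apply: ler_prod => i _; rewrite normr_ge0 Ab.
Qed.

Lemma row_free_col_mx r (X : 'M[R]_(r, n)) (v : 'rV[R]_n) :
  row_free X -> ~~ (v <= X)%MS -> row_free (col_mx X v).
Proof.
move=> fX vX; rewrite /row_free eqn_leq rank_leq_row/= [leqLHS]addn1.
have : (X < X + v)%MS.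
  by rewrite ltmxE addsmxSl/=; apply: contra vX; apply: submx_trans (addsmxSr _ _).
by rewrite ltmxErank => /andP[_]; rewrite addsmxE (eqP fX).
Qed.

(* Among the r-tuples of points of K, r being the dimension of K, take one whose
   determinant (in coordinates on the affine hull) is at least half of the
   supremum. By Cramer's rule a coordinate of a point of K in the resulting frame
   is a quotient of two such determinants. *)
Lemma body_frame K : exists (p : 'rV[R]_n) (r : nat) (Y : 'M[R]_(r, n)),
  [/\ row_free Y, body_set K p, forall i, body_set K (p + row i Y) &
    forall x, body_set K x -> exists2 l : 'rV[R]_r,
      x = p + l *m Y & forall i, `|l 0 i| <= 2].
Proof.
have [p Kp] := body_nonempty K.
pose P r := `[< exists Y : 'M[R]_(r, n),
  row_free Y /\ forall i, body_set K (p + row i Y) >].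
have exP : exists r, P r.
  exists 0%N; apply/asboolP; exists 0; split; last by case.
  by rewrite /row_free eqn_leq rank_leq_row.
have Pn r : P r -> (r <= n)%N.
  by move=> /asboolP[Y [/eqP rY _]]; rewrite -[leqLHS]rY rank_leq_col.
case: (ex_maxnP exP Pn) => r /asboolP[X [fX KX]] rmax.
(* By maximality of [r]: a point outside the span would extend the frame. *)
have span x : body_set K x -> (x - p <= X)%MS.
  move=> Kx; apply/negP => /negP xX.
  suff /rmax : P (r + 1)%N by rewrite addn1 ltnn.
  apply/asboolP; exists (col_mx X (x - p)); split; first exact: row_free_col_mx.
  move=> i; case: (splitP i) => j ij.
    rewrite (_ : i = lshift 1 j); last exact/val_inj.
    by rewrite rowKu; exact: KX.
  rewrite (_ : i = rshift r j); last exact/val_inj.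
  by rewrite rowKd ord1 row_id addrC subrK.
pose co x : 'rV[R]_r := (x - p) *m pinvmx X.
have coK x : body_set K x -> co x *m X = x - p.
  by move=> Kx; exact/mulmxKpV/span.
have [b cob] : exists b, forall x i, body_set K x -> `|co x 0 i| <= b.
  (* The i-th coordinate is an affine function with linear part [dot^~ (u i)], so the support
     function at [u i] and [- u i] bounds it on [K]. *)
  pose u i := (col i (pinvmx X))^T.
  pose b i := `|support K (u i)| + `|support K (- u i)| + `|dot p (u i)|.
  exists (\sum_i b i) => x i Kx; apply: (@le_trans _ _ (b i)); last first.
    rewrite (bigD1 i)//= lerDl sumr_ge0// => j _.
    by rewrite !addr_ge0.
  have -> : co x 0 i = dot x (u i) - dot p (u i).
    by rewrite -dotBl dotE mxE; apply: eq_bigr => j _; rewrite !mxE.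
  rewrite (le_trans (ler_normB _ _))// lerD2r ler_norml.
  have := support_ub (u i) Kx; have := support_lb (u i) Kx.
  have := ler_norm (support K (u i)); have := ler_norm (support K (- u i)).
  have := normr_ge0 (support K (u i)); have := normr_ge0 (support K (- u i)).
  by move=> *; apply/andP; split; lra.
pose Z (f : 'I_r -> 'rV[R]_n) : 'M[R]_r := \matrix_i co (f i).
pose S := [set `|\det (Z f)| | f in [set f | forall i, body_set K (f i)]].
(* The starting frame has determinant 1, so the supremum is positive and a determinant above half of
   it is nonzero. *)
have S1 : S 1.
  exists (fun i => p + row i X) => //=.
  rewrite (_ : Z _ = 1%:M) ?det1 ?normr1//; apply/row_matrixP => i.
  by rewrite rowK /co addrC addKr -row_mul mulmxVp.
have supS : has_sup S.
  split; first by exists 1.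
  exists (\sum_(s : 'S_r) b ^+ r) => _ [f Kf <-].
  by apply: ler_norm_det => i j; rewrite mxE; exact: cob.
have s1 : 1 <= sup S by apply: sup_upper_bound.
have s0 : 0 < sup S / 2 by rewrite divr_gt0// (lt_le_trans ltr01).
have [_ [f Kf <-]] := sup_adherent s0 supS.
rewrite {1}[sup S]splitr addrK => detf.
have Zu : Z f \in unitmx by rewrite unitmxE unitfE -normr_gt0 (lt_trans s0).
pose Y := \matrix_i (f i - p).
have YE : Y = Z f *m X.
  by apply/row_matrixP => i; rewrite row_mul !rowK coK.
exists p, r, Y; split=> //.
- rewrite YE /row_free mxrankMfree// mxrank_unit//.
- by move=> i; rewrite rowK addrC subrK; exact: Kf.
move=> x Kx; pose l := co x *m invmx (Z f).
have lY : l *m Y = x - p by rewrite YE /l mulmxA mulmxKV ?coK.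
exists l => [|i]; first by rewrite lY addrC subrK.
(* Cramer's rule: replacing the i-th point by [x] multiplies the determinant by [l 0 i], and the new
   determinant is still at most [sup S]. *)
pose g k := if k == i then x else f k.
have Kg k : body_set K (g k) by rewrite /g; case: ifP.
have lE : \det (Z g) = \det (Z f) * l 0 i.
  transitivity ((co x *m \adj (Z f)) 0 i).
    rewrite (expand_det_row _ i) mxE; apply: eq_bigr => j _.
    rewrite !mxE /g eqxx; congr (_ * (_ * \det _)).
    by apply/matrixP => k k'; rewrite !mxE /g eq_sym (negPf (neq_lift _ _)).
  rewrite -[co x](mulmxKV Zu) -/l -mulmxA mul_mx_adj.
  by rewrite mul_mx_scalar mxE.
have : `|\det (Z g)| <= sup S by apply: sup_upper_bound => //; exists g.
rewrite lE normrM => h.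
have d0 : 0 < `|\det (Z f)| := lt_trans s0 detf.
rewrite -(ler_pM2l d0) (le_trans h)//.
by rewrite -ler_pdivrMr// ltW.
Qed.

(** The coordinates sum to at most r/(m+1), hence at most 1, so the small box lies in the simplex
    with vertices [p] and [p + row i Y]; the vertex [p] gets the remaining weight [1 - s]. *)
Lemma frame_box K (p : 'rV[R]_n) r (Y : 'M[R]_(r, n)) m :
  body_set K p -> (forall i, body_set K (p + row i Y)) -> (r <= m.+1)%N ->
  forall l : 'rV[R]_r, (forall i, 0 <= l 0 i <= m.+1%:R^-1) ->
  body_set K (p + l *m Y).
Proof.
move=> Kp KY rm l l01; set s := \sum_i l 0 i.
have s1 : s <= 1.
  apply: (@le_trans _ _ (\sum_(i < r) m.+1%:R^-1)).
    by apply: ler_sum => i _; case/andP: (l01 i).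
  rewrite sumr_const card_ord -[leLHS]mulr_natl ler_pdivrMr// mul1r.
  by rewrite ler_nat.
pose c := fun i => if unlift ord0 i is Some j then l 0 j else 1 - s.
pose a := fun i => if unlift ord0 i is Some j then p + row j Y else p.
have -> : p + l *m Y = \sum_(i < r.+1) c i *: a i.
  rewrite big_ord_recl /c /a unlift_none.
  under eq_bigr do rewrite liftK scalerDr.
  rewrite big_split/= -scaler_suml -/s addrA -scalerDl subrK scale1r.
  by rewrite mulmx_sum_row.
apply: convex_set_sum.
- exact: body_convex.
- move=> i; rewrite /c; case: unliftP => [j _|_]; last by rewrite subr_ge0.
  by case/andP: (l01 j).
- rewrite big_ord_recl /c unlift_none.
  by under eq_bigr do rewrite liftK; rewrite subrK.
- by move=> i; rewrite /a; case: unliftP.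
Qed.

End Frame.

(** * The operators aK + b(-K) *)

Section CombinationOperator.
Context {R : realType}.

Lemma linear_image_combination n (a b : R) (g : 'M[R]_n) (K : convex_body R n) :
  combination a b (linear_image g K) = linear_image g (combination a b K).
Proof.
apply/convex_body_eq/seteqP; split.
  move=> _ /combinationP[_ [_ [[x Kx <-] [y Ky <-] ->]]].
  exists (a *: x - b *: y); first by apply/combinationP; exists x, y.
  by rewrite mulmxBl -!scalemxAl.
move=> _ [_ /combinationP[x [y [Kx Ky ->]]] <-].
apply/combinationP; exists (x *m g), (y *m g).
by split; [exists x | exists y | rewrite mulmxBl -!scalemxAl].
Qed.

Lemma enormZ n (a : R) (x : 'rV[R]_n) : enorm (a *: x) = `|a| * enorm x.
Proof.
rewrite /enorm -sqrtr_sqr -sqrtrM ?sqr_ge0// mulr_sumr; congr Num.sqrt.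
by apply: eq_bigr => i _; rewrite mxE exprMn.
Qed.

Lemma hausdorff_radii_combination n (a b r : R) (K L : convex_body R n) :
  0 <= a -> 0 <= b -> hausdorff_radii K L r ->
  hausdorff_radii (combination a b K) (combination a b L) ((a + b) * r).
Proof.
move=> a0 b0 [r0 KL LK].
have E x x' y y' : enorm (x - x') <= r -> enorm (y - y') <= r ->
    enorm (a *: x - b *: y - (a *: x' - b *: y') : 'rV[R]_n) <= (a + b) * r.
  move=> xr yr.
  rewrite (_ : _ - _ = a *: (x - x') + b *: (y' - y)); last first.
    by apply/rowP => i; rewrite !mxE; ring.
  rewrite (le_trans (enorm_triangle _ _))// !enormZ (ger0_norm a0) (ger0_norm b0).
  by rewrite mulrDl lerD// ler_wpM2l// enormC.
split; first by rewrite mulr_ge0// addr_ge0.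
  move=> _ /combinationP[x [y [Kx Ky ->]]].
  have [x' Lx' xx'] := KL _ Kx; have [y' Ly' yy'] := KL _ Ky.
  exists (a *: x' - b *: y'); last exact: E.
  by apply/combinationP; exists x', y'.
move=> _ /combinationP[x [y [Lx Ly ->]]].
have [x' Kx' xx'] := LK _ Lx; have [y' Ky' yy'] := LK _ Ly.
exists (a *: x' - b *: y'); last exact: E.
by apply/combinationP; exists x', y'.
Qed.

Lemma combination_continuous n (a b : R) : 0 <= a -> 0 <= b ->
  continuous (@combination R n a b).
Proof.
move=> a0 b0 K A /nbhs_ballP[e /= e0 eA].
(* The map is Lipschitz with constant [a + b]; adding 1 avoids a zero denominator when both
   coefficients vanish. *)
have d0 : 0 < e / (a + b + 1) by rewrite divr_gt0// ltr_wpDl// addr_ge0.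
apply/nbhs_ballP; exists (e / (a + b + 1)) => //= L.
rewrite ballEmdist /= => KL; apply: eA; rewrite ballEmdist /=.
have {}KL : hausdorff_dist K L < e / (a + b + 1) := KL.
have d1 : 0 < e / (a + b + 1) - hausdorff_dist K L by rewrite subr_gt0.
have [r rKL] := inf_adherent d1 (hausdorff_radii_has_inf K L).
rewrite -/(hausdorff_dist K L) addrC subrK => re.
have [r0 _ _] := rKL.
apply: le_lt_trans (hausdorff_dist_le (hausdorff_radii_combination a0 b0 rKL)) _.
move: re; rewrite ltr_pdivlMr ?ltr_wpDl ?addr_ge0// mulrC.
by apply: le_lt_trans; rewrite ler_wpM2r// lerDl.
Qed.

(** Frame coordinates of points of [K] are at most 2 in absolute value, so those of a difference
    [a *: x - b *: y] are at most 2(a + b), and [vol_cover] applies. The exponent [n.+1] in place of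
    [r] makes the constant independent of [K]. *)
Lemma combination_rogers_shephard n (a b : R) : 0 <= a -> 0 <= b ->
  rogers_shephard (@combination R n.+1 a b).
Proof.
move=> a0 b0; set c := (Num.truncn (2 * (a + b))).+1.
have cab : 2 * (a + b) <= c%:R.
  have ab0 : 0 <= 2 * (a + b) by rewrite mulr_ge0// addr_ge0.
  by have /andP[_ /ltW] := truncn_itv ab0.
exists ((c.*2 * n.+1).+1 ^ n.+1)%:R; first by rewrite ltr0n expn_gt0.
move=> K; have [p [r [Y [fY Kp KY Kl]]]] := body_frame K.
have rn : (r <= n.+1)%N by rewrite -[leqLHS](eqP fY) rank_leq_col.
apply: (@le_trans _ _ (((c.*2 * n.+1).+1 ^ r)%:R%:E * vol K)%E).
  apply: (@vol_cover _ _ _ _ _ Y p (a *: p - b *: p)).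
    exact: frame_box.
  move=> _ /combinationP[x [y [/Kl[l -> l2] /Kl[l' -> l2'] ->]]].
  exists (a *: l - b *: l').
    rewrite !scalerDr mulmxBl -!scalemxAl.
    by apply/rowP => i; rewrite !mxE; ring.
  move=> i; rewrite !mxE (le_trans (ler_normB _ _))// !normrM.
  rewrite (ger0_norm a0) (ger0_norm b0) (le_trans _ cab)//.
  rewrite mulrDr ![2 * _]mulrC; apply: lerD; exact: ler_wpM2l.
apply: lee_wpmul2r; first exact: measure_ge0.
by rewrite lee_fin ler_nat leq_pexp2l.
Qed.

(** If the frame of [K] spanned the space, finitely many translates of [K] would cover the unit
    cube, which has volume 1. Hence some nonzero [v] is orthogonal to the frame and constant on
    [K]. *)
Lemma vol0_flat n (K : convex_body R n.+1) : vol K = 0%E ->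
  exists2 v, v != 0 & support K (- v) = - support K v.
Proof.
move=> K0; have [p [r [Y [fY Kp KY Kl]]]] := body_frame K.
have rn : (r <= n.+1)%N by rewrite -[leqLHS](eqP fY) rank_leq_col.
have [fullY|/negP fullY] := boolP (row_full Y).
  (* Bounds the i-th frame coordinate of every point of the unit cube. *)
  pose b i := \sum_j `|pinvmx Y j i|.
  have b0 i : 0 <= b i by rewrite sumr_ge0.
  set c := (Num.truncn (\sum_i b i)).+1.
  have bc : \sum_i b i <= c%:R.
    have S0 : 0 <= \sum_i b i by rewrite sumr_ge0.
    by have /andP[_ /ltW] := truncn_itv S0.
  suff : (vol (@unit_cube R n.+1) <= ((c.*2 * n.+1).+1 ^ r)%:R%:E * vol K)%E.
    by rewrite K0 mule0 vol_unit_cube lee_fin ler10.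
  apply: (@vol_cover _ _ _ _ _ Y p 0); first exact: frame_box.
  move=> x /unit_cubeP x01; exists (x *m pinvmx Y).
    by rewrite add0r -mulmxA mulVpmx// mulmx1.
  move=> i; rewrite mxE (le_trans _ bc)// (bigD1 i)//=.
  rewrite (@le_trans _ _ (b i))//; last by rewrite lerDl sumr_ge0.
  rewrite (le_trans (ler_norm_sum _ _ _))//; apply: ler_sum => j _.
  have := x01 j; rewrite in_itv/= => /andP[x0 x1].
  by rewrite normrM ler_piMl// ger0_norm.
pose v := nz_row (kermx Y^T).
have Yv : v *m Y^T = 0 by apply/sub_kermxP; exact: nz_row_sub.
have v0 : v != 0.
  rewrite nz_row_eq0 kermx_eq0; apply/negP => fYT; apply: fullY.
  by rewrite /row_full -mxrank_tr; exact: fYT.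
have dE x : body_set K x -> dot x v = dot p v.
  move=> /Kl[l -> _]; rewrite dotDl /dot -mulmxA.
  rewrite -[Y *m v^T]trmxK trmx_mul trmxK Yv trmx0 mulmx0.
  by rewrite [X in _ + X]mxE addr0.
exists v => //.
have [x Kx <-] := support_max K v; have [y Ky <-] := support_max K (- v).
by rewrite dotNr !dE.
Qed.

End CombinationOperator.

(** * Covariant operators *)

Section Covariance.
Context {R : realType} {n : nat}.
Implicit Types (K L : convex_body R n) (g : 'M[R]_n) (u v : 'rV[R]_n).

(** A [t] making [g + t%:M] singular is a root of the characteristic polynomial of [- g]. The
    distinct values e/(k+1), for k below the size of that polynomial, are too many to be all
    roots. *)
Lemma unitmx_perturb g (e : R) : 0 < e ->
  exists t, [/\ 0 < t, t <= e & g + t%:M \in unitmx].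
Proof.
move=> e0; apply: contrapT => noT.
pose q := char_poly (- g).
pose t k : R := e / k.+1%:R.
have q0 : q != 0 by rewrite monic_neq0// char_poly_monic.
suff : (size (map t (iota 0 (size q))) < size q)%N.
  by rewrite size_map size_iota ltnn.
apply: max_poly_roots => //; last first.
  rewrite map_inj_uniq ?iota_uniq// => i j /(congr1 (fun x => e / x)).
  rewrite /t !invfM !mulrA !divff ?gt_eqF// !mul1r !invrK => /eqP.
  by rewrite eqr_nat eqSS => /eqP.
apply/allP => _ /mapP[k _ ->]; rewrite -eigenvalue_root_char.
apply: contraT; rewrite /eigenvalue kermx_eq0 row_free_unit negbK -opprD.
rewrite -scaleN1r unitmxZ ?unitrN1// => gt; exfalso; apply: noT.
exists (t k); split; rewrite ?divr_gt0//.
by rewrite ler_pdivrMr// ler_peMr ?(ltW e0)// ler1n.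
Qed.

Lemma hausdorff_dist_perturb K g t r : 0 <= t ->
  (forall x, body_set K x -> enorm x <= r) ->
  hausdorff_dist (linear_image (g + t%:M) K) (linear_image g K) <= t * r.
Proof.
move=> t0 Kr.
have E x : body_set K x -> enorm (x *m (g + t%:M) - x *m g) <= t * r.
  move=> Kx; rewrite mulmxDr addrAC subrr add0r mul_mx_scalar enormZ ger0_norm//.
  by rewrite ler_wpM2l ?Kr.
have [x0 Kx0] := body_nonempty K.
apply: hausdorff_dist_le; split.
- by rewrite mulr_ge0// (le_trans (enorm_ge0 x0))// Kr.
- by move=> _ [x Kx <-]; exists (x *m g); [exists x | exact: E].
- by move=> _ [x Kx <-]; exists (x *m (g + t%:M)); [exists x | exact: E].
Qed.

(* The invertible matrices are dense. *)
Lemma covariant_singular (D : convex_body R n -> convex_body R n) :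
  continuous D -> gl_covariant D ->
  forall K g, D (linear_image g K) = linear_image g (D K).
Proof.
move=> cD glD K g; apply: hausdorff_dist_eq0; apply/le_anti.
rewrite hausdorff_dist_ge0 andbT; apply/ler_addgt0Pr => e e0; rewrite add0r.
have e2 : 0 < e / 2 by rewrite divr_gt0.
have /(cD _) /nbhs_ballP[d /= d0 dD] :=
  nbhsx_ballx (D (linear_image g K)) _ e2.
have [r r0 Kr] := body_enorm_bounded K.
have [s s0 Ds] := body_enorm_bounded (D K).
(* The first bound keeps the perturbed image of [K] within the continuity radius [d], the second
   moves the image of [D K] by at most [e / 2]. *)
have m0 : 0 < Num.min (d / (r + 1)) (e / 2 / (s + 1)).
  by rewrite lt_min !divr_gt0// ltr_wpDl.
have [t [t0 + gt]] := unitmx_perturb g m0.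
rewrite le_min => /andP[]; rewrite ler_pdivlMr ?ltr_wpDl// => td.
rewrite ler_pdivlMr ?ltr_wpDl// => te.
set h := g + t%:M in gt.
have KL : hausdorff_dist (linear_image g K) (linear_image h K) < d.
  rewrite hausdorff_distC (le_lt_trans (hausdorff_dist_perturb g (ltW t0) Kr))//.
  by rewrite (lt_le_trans _ td)// ltr_pM2l// ltrDl.
have DL : hausdorff_dist (D (linear_image g K)) (D (linear_image h K)) < e / 2.
  have /dD : ball (linear_image g K) d (linear_image h K) by rewrite ballEmdist.
  by rewrite /= ballEmdist.
rewrite (le_trans (hausdorff_dist_triangle (D (linear_image h K)) _ _))//.
rewrite [leRHS]splitr lerD// ?(ltW DL)// glD//.
rewrite (le_trans (hausdorff_dist_perturb g (ltW t0) Ds))// (le_trans _ te)//.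
by rewrite ler_pM2l// lerDl.
Qed.

(** The segment from a minimiser to a maximiser of [dot^~ u] lies in [K] and takes all values in
    between. *)
Lemma support_ivt K u (a : R) : - support K (- u) <= a <= support K u ->
  exists2 x, body_set K x & dot x u = a.
Proof.
have [x Kx xE] := support_max K u; have [y Ky] := support_max K (- u).
rewrite dotNr => yE; rewrite -yE -xE opprK => /andP[ya ax].
have [xy|xy] := eqVneq (dot y u) (dot x u).
  by exists x => //; apply/le_anti; rewrite ax -xy ya.
have xy0 : 0 < dot x u - dot y u.
  by rewrite subr_gt0 lt_neqAle xy (le_trans ya).
pose t := (a - dot y u) / (dot x u - dot y u).
exists (t *: x + (1 - t) *: y).
  apply: (convex_setP _).1 => //; first exact: body_convex.
    by apply: divr_ge0; [rewrite subr_ge0 | exact: ltW].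
  by rewrite ler_pdivrMr// mul1r lerD2r.
rewrite dotDl !dotZl mulrBl mul1r addrCA -mulrBr divfK ?gt_eqF//.
by rewrite addrC subrK.
Qed.

End Covariance.

(* Project K along u and L along w onto the same coordinate axis: the two images
   are the same segment. *)
Lemma covariant_support (R : realType) n
    (D : convex_body R n.+1 -> convex_body R n.+1) (K L : convex_body R n.+1)
    (u w : 'rV[R]_n.+1) :
  continuous D -> gl_covariant D ->
  support K u = support L w -> support K (- u) = support L (- w) ->
  support (D K) u = support (D L) w.
Proof.
move=> cD glD uw uwN; pose e : 'rV[R]_n.+1 := delta_mx 0 0.
(* This matrix has rank at most one, so covariance under singular matrices is needed here. *)
have projE x v : x *m (v^T *m e) = dot x v *: e.
  by rewrite mulmxA [x *m _]mx11_scalar mul_scalar_mx.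
have KL : linear_image (u^T *m e) K = linear_image (w^T *m e) L.
  apply/convex_body_eq/seteqP; split=> _ [x Kx <-] /=.
    have [|y Ly yE] := @support_ivt _ _ L w (dot x u).
      by rewrite -uw -uwN support_ub ?support_lb.
    by exists y; rewrite // !projE yE.
  have [|y Ly yE] := @support_ivt _ _ K u (dot x w).
    by rewrite uw uwN support_ub ?support_lb.
  by exists y; rewrite // !projE yE.
have := congr1 D KL; rewrite !(covariant_singular cD glD) => DKL.
suff H A B (v v' : 'rV[R]_n.+1) :
    linear_image (v^T *m e) A = linear_image (v'^T *m e) B ->
    support A v <= support B v'.
  by apply/le_anti; rewrite !H.
move=> AB; apply: support_le => x Ax.
have : body_set (linear_image (v'^T *m e) B) (x *m (v^T *m e)).
  by rewrite -AB; exists x.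
move=> [y By]; rewrite !projE => /rowP/(_ 0); rewrite !mxE !eqxx !mulr1 => <-.
exact: support_ub.
Qed.

(** * Symmetric sublinear functions of two variables with zero width in some direction *)

Section SymmetricSublinear.
Context {R : realType} (phi : R -> R -> R).
Hypothesis phiD : forall p q p' q',
  phi (p + p') (q + q') <= phi p q + phi p' q'.
Hypothesis phiZ : forall t p q, 0 <= t -> phi (t * p) (t * q) = t * phi p q.
Hypothesis phiC : forall p q, phi p q = phi q p.

(** Zero width at (1, 1) makes [phi] additive along the diagonal, and a pair with [q <= p] is a
    diagonal vector plus a nonnegative multiple of (1, -1). So [phi 1 1] and [phi 1 (-1)] determine
    [phi] there. *)
Lemma symmetric_sublinear p0 q0 :
  phi 1 0 <= phi 1 (-1) -> phi 0 (-1) <= phi 1 (-1) ->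
  ~ (p0 = 0 /\ q0 = 0) -> phi p0 q0 + phi (- p0) (- q0) = 0 ->
  exists a b, [/\ 0 <= a, 0 <= b & forall p q, q <= p -> phi p q = a * p - b * q].
Proof.
move=> F1 F2 pq0 W0.
have phi00 : phi 0 0 = 0 by have := phiZ 0 0 (lexx 0); rewrite !mul0r.
have W11 : phi 1 1 + phi (-1) (-1) = 0.
  apply/le_anti/andP; split; last first.
    by rewrite -phi00 -(subrr 1); exact: phiD.
  set s := p0 + q0.
  (* By symmetry the width also vanishes at (q0, p0), and (p0, q0) + (q0, p0) = (s, s). This settles
     the case of nonzero [s]. *)
  have Ws : phi s s + phi (- s) (- s) <= 0.
    have := phiD p0 q0 q0 p0; have := phiD (- p0) (- q0) (- q0) (- p0).
    rewrite -/s (addrC q0 p0) -/s (addrC (- q0)) -!opprD -/s.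
    by rewrite (phiC q0) (phiC (- q0)); lra.
  have [s0|s0|s0] := ltgtP s 0.
  - have N0 : 0 <= - s by rewrite oppr_ge0 ltW.
    have := phiZ 1 1 N0; have := phiZ (-1) (-1) N0; rewrite mulrN1 opprK mulr1.
    by move=> E1 E2; move: Ws; rewrite E1 E2; nra.
  - have := phiZ 1 1 (ltW s0); have := phiZ (-1) (-1) (ltW s0).
    by rewrite mulrN1 mulr1 => E1 E2; move: Ws; rewrite E1 E2; nra.
  have qp : q0 = - p0 by apply/eqP; rewrite -addr_eq0 addrC; apply/eqP.
  have p00 : p0 != 0.
    by apply/eqP => p00; apply: pq0; rewrite qp p00 oppr0.
  have d0 : phi 1 (-1) = 0.
    move: W0; rewrite qp opprK (phiC (- p0)) => W0.
    have [pn|pp|pz] := ltgtP p0 0; last by rewrite pz eqxx in p00.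
      have N0 : 0 <= - p0 by rewrite oppr_ge0 ltW.
      have E := phiZ 1 (-1) N0; rewrite mulrN1 opprK mulr1 (phiC (- p0)) in E.
      have /eqP : - p0 * phi 1 (-1) = 0 by lra.
      by rewrite mulf_eq0 oppr_eq0 (negPf p00) => /eqP.
    have E := phiZ 1 (-1) (ltW pp); rewrite mulrN1 mulr1 in E.
    have /eqP : p0 * phi 1 (-1) = 0 by lra.
    by rewrite mulf_eq0 (negPf p00) => /eqP.
  (* Splitting (1, 1) and (-1, -1) into coordinates bounds the width by 2 phi(1, 0) + 2 phi(0, -1),
     which is at most 4 phi(1, -1) = 0. *)
  have := phiD 1 0 0 1; have := phiD (-1) 0 0 (-1).
  rewrite !addr0 !add0r (phiC 0 1) (phiC (-1) 0); lra.
set c := phi 1 1 in W11 *; set d := phi 1 (-1) in F1 F2 *.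
have diag t : phi t t = c * t.
  have [t0|t0] := leP 0 t.
    by rewrite -[in LHS](mulr1 t) phiZ// mulrC.
  have N0 : 0 <= - t by rewrite oppr_ge0 ltW.
  have := phiZ (-1) (-1) N0; rewrite mulrN1 opprK => ->.
  by rewrite (_ : phi (-1) (-1) = - c); [ring | lra].
have phiE p q : q <= p -> phi p q = c * ((p + q) / 2) + d * ((p - q) / 2).
  move=> qp; set s := (p + q) / 2; set r := (p - q) / 2.
  have r0 : 0 <= r by rewrite divr_ge0// subr_ge0.
  have dr : phi r (- r) = d * r.
    by have := phiZ 1 (-1) r0; rewrite mulr1 mulrN1 mulrC.
  have pE : p = s + r by rewrite /s /r; field.
  have qE : q = s - r by rewrite /s /r; field.
  (* Adding the diagonal part gives one inequality, subtracting it again gives the other. *)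
  have := phiD s s r (- r); rewrite -pE -qE diag dr => le1.
  have := phiD p q (- s) (- s); rewrite diag.
  rewrite (_ : p - s = r); last by rewrite pE; ring.
  rewrite (_ : q - s = - r); last by rewrite qE; ring.
  by rewrite dr => le2; apply/le_anti/andP; split; lra.
(* These are the values of [phi] at (1, 0) and (0, -1); the first is nonnegative by [F2], the second
   by [F1]. *)
exists ((c + d) / 2), ((d - c) / 2); split.
- by move: F2; rewrite phiE; lra.
- by move: F1; rewrite phiE; lra.
- by move=> p q /phiE ->; field.
Qed.

End SymmetricSublinear.

(** * The segment, triangle and simplex on which the operator is tested *)

Section TestBodies.
Context {R : realType} {m : nat}.
Local Notation n := m.+2.

Definition plane_vec (p q : R) : 'rV[R]_n :=
  p *: delta_mx 0 0 + q *: delta_mx 0 (lift ord0 ord0).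

Lemma plane_vecD p q p' q' :
  plane_vec (p + p') (q + q') = plane_vec p q + plane_vec p' q'.
Proof. by rewrite /plane_vec !scalerDl addrACA. Qed.

Lemma plane_vecZ t p q : plane_vec (t * p) (t * q) = t *: plane_vec p q.
Proof. by rewrite /plane_vec scalerDr !scalerA. Qed.

Lemma plane_vecN p q : plane_vec (- p) (- q) = - plane_vec p q.
Proof. by rewrite /plane_vec !scaleNr opprD. Qed.

Lemma dot_delta (j : 'I_n) (u : 'rV[R]_n) : dot (delta_mx 0 j) u = u 0 j.
Proof. by rewrite /dot -rowE !mxE. Qed.

Lemma plane_vec0 p q : plane_vec p q 0 0 = p.
Proof. by rewrite !mxE eqxx/= mulr1 mulr0 addr0. Qed.

Lemma plane_vec1 p q : plane_vec p q 0 (lift ord0 ord0) = q.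
Proof. by rewrite !mxE eqxx/= mulr1 mulr0 add0r. Qed.

(** The segment from e_1 to e_2. For [q <= p] its support function is [p] at [plane_vec p q] and
    [- q] at the opposite vector, so it realises every pair of values h_K(u), h_K(-u). *)
Definition test_segment : convex_body R n :=
  polytope (\matrix_(i < 2) (delta_mx 0 (if i == 0 then 0 else lift ord0 ord0))).

Lemma support_test_segment p q :
  support test_segment (plane_vec p q) = Num.max p q.
Proof.
rewrite /test_segment; set P := (X in polytope X).
have P0 : dot (row 0 P) (plane_vec p q) = p.
  by rewrite rowK dot_delta plane_vec0.
have P1 : dot (row 1 P) (plane_vec p q) = q.
  by rewrite rowK dot_delta plane_vec1.
case: leP => pq.
  rewrite -[RHS]P1; apply: support_polytope; case=> -[|[|//]] i.
    by rewrite (_ : Ordinal i = 0) ?P0 ?P1//; exact/val_inj.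
  by rewrite (_ : Ordinal i = 1)//; exact/val_inj.
rewrite -[RHS]P0; apply: support_polytope; case=> -[|[|//]] i.
  by rewrite (_ : Ordinal i = 0)//; exact/val_inj.
by rewrite (_ : Ordinal i = 1) ?P0 ?P1 ?ltW//; exact/val_inj.
Qed.

Definition test_triangle : convex_body R n :=
  polytope (\matrix_(i < 3) (if i == 0 then 0 else
    delta_mx 0 (if i == 1 then 0 else lift ord0 ord0))).

Lemma support_test_triangle p q :
  support test_triangle (plane_vec p q) = Num.max 0 (Num.max p q).
Proof.
rewrite /test_triangle; set P := (X in polytope X).
have P0 : dot (row 0 P) (plane_vec p q) = 0 by rewrite rowK /dot mul0mx mxE.
have P1 : dot (row 1 P) (plane_vec p q) = p.
  by rewrite rowK dot_delta plane_vec0.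
have P2 : dot (row 2 P) (plane_vec p q) = q.
  by rewrite rowK dot_delta plane_vec1.
apply/le_anti/andP; split; last first.
  rewrite !ge_max; apply/and3P; split.
  - by rewrite -[leLHS]P0 support_ub//; exact: polytope_row.
  - by rewrite -[leLHS]P1 support_ub//; exact: polytope_row.
  - by rewrite -[leLHS]P2 support_ub//; exact: polytope_row.
apply: support_le; apply: polytope_dot_le; case=> -[|[|[|//]]] i.
- by rewrite (_ : Ordinal i = 0) ?P0 ?le_max ?lexx//; exact/val_inj.
- by rewrite (_ : Ordinal i = 1) ?P1 ?le_max ?lexx ?orbT//; exact/val_inj.
- by rewrite (_ : Ordinal i = 2) ?P2 ?le_max ?lexx ?orbT//; exact/val_inj.
Qed.

(** The vertices are e_1 and the sums e_1 + e_i for the other i. They form a basis but lie in the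
    hyperplane where the first coordinate is 1. *)
Definition test_simplex : convex_body R n :=
  polytope (\matrix_(i < n) \row_j ((j == 0) || (j == i))%:R).

Lemma vol_test_simplex : vol test_simplex = 0%E.
Proof.
apply: (@vol_hyperplane0 _ _ _ 1) => x Tx.
rewrite -dot_delta dotC; apply/le_anti/andP; split.
  apply: polytope_dot_le Tx => i.
  by rewrite dotC dot_delta !mxE eqxx.
rewrite -lerN2 -dotNr; apply: polytope_dot_le Tx => i.
by rewrite dotNr dotC dot_delta !mxE eqxx.
Qed.

(** Such a [v] is orthogonal to all vertices, and these form a basis. *)
Lemma support_test_simplex_eq0 v :
  support test_simplex v = 0 -> support test_simplex (- v) = 0 -> v = 0.
Proof.
move=> v0 v0N; set P := \matrix_(i < n) \row_j ((j == 0) || (j == i))%:R : 'M[R]_n.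
have Pv i : dot (row i P) v = 0.
  have Ti : body_set test_simplex (row i P) := polytope_row P i.
  apply/le_anti/andP; split; first by rewrite -v0 support_ub.
  by rewrite -[leLHS]oppr0 -v0N support_lb.
have v00 : v 0 0 = 0.
  rewrite -dot_delta -[RHS](Pv 0); congr dot; apply/rowP => j.
  by rewrite !mxE orbb.
apply/rowP => i; rewrite mxE; have [->//|i0] := eqVneq i 0.
transitivity (dot (delta_mx 0 0 + delta_mx 0 i) v).
  by rewrite dotDl !dot_delta v00 add0r.
rewrite -[RHS](Pv i); congr dot.
apply/rowP => j; rewrite !mxE; have [->|j0] := eqVneq j 0.
  by rewrite eq_sym (negPf i0) addr0.
by rewrite add0r.
Qed.

End TestBodies.

(** * The support function of D K for an operator with the three properties *)

Section Classification.
Context {R : realType} {m : nat}.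
Local Notation n := m.+2.
Variable D : convex_body R n -> convex_body R n.
Hypotheses (cD : continuous D) (glD : gl_covariant D) (rsD : rogers_shephard D).

Let phi p q := support (D test_segment) (plane_vec p q).

Let phiE K u : support (D K) u = phi (support K u) (- support K (- u)).
Proof.
apply: covariant_support => //.
  by rewrite support_test_segment max_l// support_gap.
rewrite -plane_vecN support_test_segment opprK max_r//.
by rewrite lerNl support_gap.
Qed.

(** The support function of the segment takes the same values at (p, q) and (q, p), and likewise at
    their opposites, so [covariant_support] identifies the two values. *)
Let phiC p q : phi p q = phi q p.
Proof.
apply: covariant_support => //; rewrite -?plane_vecN !support_test_segment.
  exact: maxC.
exact: maxC.
Qed.

Let phiD p q p' q' : phi (p + p') (q + q') <= phi p q + phi p' q'.
Proof. by rewrite /phi plane_vecD supportD. Qed.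

Let phiZ t p q : 0 <= t -> phi (t * p) (t * q) = t * phi p q.
Proof. by move=> t0; rewrite /phi plane_vecZ supportZ. Qed.

Let triangleE p q : q <= p -> support (D test_triangle) (plane_vec p q) =
  phi (Num.max 0 p) (Num.min 0 q).
Proof.
move=> qp; rewrite phiE -plane_vecN !support_test_triangle oppr_max oppr0.
by rewrite oppr_max !opprK (max_l qp) (min_r qp).
Qed.

(** The image of the test simplex has volume zero, hence zero width in some direction [v]; [phiE]
    turns this into zero width of [phi] at a pair that is nonzero because [v] is. *)
Lemma rogers_shephard_flat : exists p q,
  ~ (p = 0 /\ q = 0) /\ phi p q + phi (- p) (- q) = 0.
Proof.
have [C C0 DC] := rsD.
have : vol (D test_simplex) = 0%E.
  apply/eqP; rewrite eq_le measure_ge0 andbT.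
  by have := DC test_simplex; rewrite vol_test_simplex mule0.
move=> /vol0_flat[v v0 flat].
exists (support test_simplex v), (- support test_simplex (- v)); split.
  move=> [h0 /eqP]; rewrite oppr_eq0 => /eqP h0'.
  by move/eqP: v0; apply; exact: support_test_simplex_eq0.
have := flat; rewrite !phiE !opprK => flat'.
by rewrite [phi (- _) _]phiC flat' subrr.
Qed.

Lemma support_linear : exists a b, [/\ 0 <= a, 0 <= b &
  forall K u, support (D K) u = a * support K u + b * support K (- u)].
Proof.
have [p0 [q0 [pq0 W0]]] := rogers_shephard_flat.
(* For the image of the triangle, (1, 1) + (1, -1) = (2, 0) gives 2 phi(1, 0) <= phi(1, 0) + phi(1,
   -1). *)
have F1 : phi 1 0 <= phi 1 (-1).
  have := supportD (D test_triangle) (plane_vec 1 1) (plane_vec 1 (-1)).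
  rewrite -plane_vecD !triangleE ?addrN; try lra.
  rewrite !max_r; try lra.
  rewrite minxx min_l ?min_r; try lra.
  rewrite (_ : phi (1 + 1) 0 = 2 * phi 1 0); first lra.
  by rewrite -phiZ// mulr0 mulr1.
(* Likewise (1, -1) + (-1, -1) = (0, -2) gives 2 phi(0, -1) <= phi(1, -1) + phi(0, -1). *)
have F2 : phi 0 (-1) <= phi 1 (-1).
  have := supportD (D test_triangle) (plane_vec 1 (-1)) (plane_vec (-1) (-1)).
  rewrite -plane_vecD !triangleE ?addrN; try lra.
  rewrite !min_r; try lra.
  rewrite maxxx max_r ?max_l; try lra.
  rewrite (_ : phi 0 (-1 - 1) = 2 * phi 0 (-1)); first lra.
  by rewrite -phiZ// mulr0 mulrN1 -opprD.
have [a [b [a0 b0 ab]]] := symmetric_sublinear phiD phiZ phiC F1 F2 pq0 W0.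
exists a, b; split=> // K u.
by rewrite phiE ab ?mulrN ?opprK// support_gap.
Qed.

End Classification.

Theorem theorem1p1 (R : realType) (n : nat) (hn : (2 <= n)%N)
    (D : convex_body R n -> convex_body R n) :
  [/\ continuous D, gl_covariant D & rogers_shephard D] <->
  exists a b : R, [/\ 0 <= a, 0 <= b &
    forall K : convex_body R n,
      (D K : set 'rV[R]_n) =
      minkowski_add (dilate a K) (dilate b (reflect_set K))].
Proof.
case: n hn D => [//|[//|m]] _ D; split.
  move=> [cD glD rsD]; have [a [b [a0 b0 DE]]] := support_linear cD glD rsD.
  exists a, b; split=> // K.
  suff -> : D K = combination a b K by [].
  by apply: support_inj => u; rewrite DE support_combination.
move=> [a [b [a0 b0 DE]]].
have -> : D = combination a b.
  by apply/funext => K; apply: convex_body_eq; exact: DE.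
split.
- exact: combination_continuous.
- by move=> K g _; exact: linear_image_combination.
- exact: combination_rogers_shephard.
Qed.
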